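(* Let $x_1,\dots,x_N$ be points in the unit ball $\mathbb{B}^n\subset\mathbb{R}^n$. (1) There exists a unique (up to a linear isometry) Möbius transformation $h$ of the unit ball onto itself such that $$\sum_{k=1}^N h(x_k)=0.$$ (2) Decompose the Möbius transformation $h$ as $h=T\circ h_c$ for some $c\in\mathbb{B}^n$ and a linear isometry $T$ of the unit ball. Then the point $c$ is the unique minimum of the function $$G_N(y)=-\sum_{i=1}^N\log\frac{(1-|y|^2)(1-|x_i|^2)}{|y-x_i|^2+(1-|x_i|^2)(1-|y|^2)},\qquad y\in\mathbb{B}^n.$$
   Context: $\mathbb{B}^n=\{x\in\mathbb{R}^n:|x|<1\}$ is the open unit ball, with Euclidean norm $|\cdot|$; $N\ge1$ is an integer. Möbius transformations of $\mathbb{B}^n$ onto itself are the maps $T\circ h_a$ with $T$ an orthogonal transformation of $\mathbb{R}^n$, $a\in\mathbb{B}^n$, and $$h_a(x)=\frac{a|x-a|^2+(1-|a|^2)(a-x)}{|x-a|^2+(1-|a|^2)(1-|x|^2)}.$$ ''Unique up to a linear isometry'' means that any two such transformations $h,\tilde h$ satisfy $\tilde h=T\circ h$ for some orthogonal transformation $T$. *)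

(* Defs.v *)
From mathcomp Require Export all_boot all_order all_algebra.
From mathcomp Require Export boolp classical_sets reals exp.

Set Implicit Arguments.
Unset Strict Implicit.
Unset Printing Implicit Defensive.

Import Order.TTheory GRing.Theory Num.Theory.

Local Open Scope classical_set_scope.
Local Open Scope ring_scope.

Section Defs.
Variables (R : realType) (n : nat).
Implicit Types (a c x y : 'rV[R]_n) (h : 'rV[R]_n -> 'rV[R]_n).

(* The library norm [`|x|] on 'rV[R]_n is the sup norm. *)
Definition enorm x : R := Num.sqrt (\sum_(j < n) x 0 j ^+ 2).

Definition unit_ball : set 'rV[R]_n := [set x | enorm x < 1].

Definition linear_isometry (T : {linear 'rV[R]_n -> 'rV[R]_n}) : Prop :=
  forall x, enorm (T x) = enorm x.

Definition moebius_h a x : 'rV[R]_n :=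
  (enorm (x - a) ^+ 2
     + (1 - enorm a ^+ 2) * (1 - enorm x ^+ 2))^-1
  *: (enorm (x - a) ^+ 2 *: a + (1 - enorm a ^+ 2) *: (a - x)).

(* Maps of the ball are represented by functions on 'rV[R]_n compared on the
   ball only; their values outside it are irrelevant. *)
Definition moebius_decomp h (T : {linear 'rV[R]_n -> 'rV[R]_n}) c : Prop :=
  [/\ linear_isometry T, unit_ball c & {in unit_ball, h =1 T \o moebius_h c}].

Definition moebius_ball h : Prop := exists T c, moebius_decomp h T c.

Definition unique_argmin (A : set 'rV[R]_n) (f : 'rV[R]_n -> R) c : Prop :=
  unique (fun z => A z /\ forall y, A y -> f z <= f y) c.

Definition GN (N : nat) (x : 'I_N -> 'rV[R]_n) y : R :=
  - \sum_(i < N)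
      ln ((1 - enorm y ^+ 2) * (1 - enorm (x i) ^+ 2)
          / (enorm (y - x i) ^+ 2
             + (1 - enorm (x i) ^+ 2) * (1 - enorm y ^+ 2))).

End Defs.

Arguments unit_ball {R n}.

(* Main.v *)
Require Import Defs.
From mathcomp Require Import ring lra.
From mathcomp Require Import functions topology normedtype sequences derive.
Import Order.TTheory GRing.Theory Num.Theory numFieldNormedType.Exports.

(** Up to a factor 2, [GN x y] is the sum of ln cosh (d(y, x_k) / 2), with d the
hyperbolic distance, and h_c is an involutive hyperbolic isometry exchanging c
and 0; so [GN x y] is also the energy of the points u_k = h_c(x_k) at
z = h_c(y), and it suffices to compare the energies at 0 and at z.
- If the u_k add up to 0, each term is bounded below, up to a constant, by a
  linear function of u_k . z, strictly when z is nonzero, because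
  s |-> ln (1 - |z| s) is strictly concave: 0 is the strict minimum.
- If w = u_1 + ... + u_N is nonzero, the energy at t w is below that at 0 for
  small t > 0, by ln v <= v - 1.
A minimum exists because exp (- GN x) extends continuously by 0 to the
sphere. *)

Set Implicit Arguments.
Unset Strict Implicit.
Unset Printing Implicit Defensive.

Local Open Scope classical_set_scope.
Local Open Scope ring_scope.

(** * The Euclidean inner product and norm *)

Section DotProduct.
Variables (R : realType) (n : nat).
Implicit Types (a b : R) (x y z : 'rV[R]_n).

Definition dot x y : R := \sum_(j < n) x 0 j * y 0 j.

Lemma dotC x y : dot x y = dot y x.
Proof. by apply: eq_bigr => j _; rewrite mulrC. Qed.

Lemma dot_combl a b x y z :
  dot (a *: x + b *: y) z = a * dot x z + b * dot y z.
Proof.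
rewrite !mulr_sumr -big_split; apply: eq_bigr => j _ /=.
by rewrite !mxE mulrDl !mulrA.
Qed.

Lemma dot_combr a b x y z :
  dot z (a *: x + b *: y) = a * dot z x + b * dot z y.
Proof. by rewrite dotC dot_combl !(dotC z). Qed.

Lemma dotZl a x z : dot (a *: x) z = a * dot x z.
Proof. by rewrite -[a *: x]addr0 -(scale0r x) dot_combl mul0r addr0. Qed.

Lemma dot0l z : dot 0 z = 0.
Proof. by rewrite -(scale0r 0) dotZl mul0r. Qed.

Lemma dot_sumr (I : finType) x (u : I -> 'rV[R]_n) :
  dot x (\sum_i u i) = \sum_i dot x (u i).
Proof.
rewrite /dot exchange_big; apply: eq_bigr => j _ /=.
by rewrite summxE mulr_sumr.
Qed.

Lemma dot_sub x y : dot (x - y) (x - y) = dot x x - 2 * dot x y + dot y y.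
Proof.
rewrite -[x - y]/(x + - y) -scaleN1r -{1 2}[x]scale1r dot_combl !dot_combr.
by rewrite (dotC y x); ring.
Qed.

Lemma dotxx_ge0 x : 0 <= dot x x.
Proof. by apply: sumr_ge0 => j _; rewrite -expr2 sqr_ge0. Qed.

Lemma dotxx_eq0 x : (dot x x == 0) = (x == 0).
Proof.
apply/idP/eqP => [|->]; last by rewrite dot0l.
rewrite psumr_eq0 => [/allP x0|j _]; last by rewrite -expr2 sqr_ge0.
apply/rowP => j; have := x0 j (mem_index_enum _).
by rewrite /= mulf_eq0 orbb mxE => /eqP.
Qed.

Lemma CauchySchwarz_dot x y : dot x y ^+ 2 <= dot x x * dot y y.
Proof.
have [->|y_neq0] := eqVneq y 0; first by rewrite dotC !dot0l expr0n mulr0.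
have y_gt0 : 0 < dot y y by rewrite lt_def dotxx_eq0 y_neq0 dotxx_ge0.
(* This vector is |y|^2 times the component of x orthogonal to y. *)
have := dotxx_ge0 (dot y y *: x + - dot x y *: y).
rewrite dot_combl !dot_combr (dotC y x) => ge0.
rewrite -subr_ge0 -(pmulr_rge0 _ y_gt0).
by apply: le_trans ge0 _; rewrite le_eqVlt; apply/orP; left; apply/eqP; ring.
Qed.

Lemma enorm_sqr x : enorm x ^+ 2 = dot x x.
Proof.
rewrite sqr_sqrtr; last by apply: sumr_ge0 => j _; exact: sqr_ge0.
by apply: eq_bigr => j _; rewrite expr2.
Qed.

Lemma enorm_eq0 x : (enorm x == 0) = (x == 0).
Proof. by rewrite -dotxx_eq0 -enorm_sqr sqrf_eq0. Qed.

Lemma enorm0 : enorm (0 : 'rV[R]_n) = 0.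
Proof. by apply/eqP; rewrite enorm_eq0. Qed.

Lemma unit_ballE x : unit_ball x <-> dot x x < 1.
Proof.
rewrite /unit_ball /= -enorm_sqr -[X in _ ^+ 2 < X](expr1n _ 2).
by rewrite ltr_pXn2r // ?nnegrE ?sqrtr_ge0.
Qed.

Lemma unit_ball0 : unit_ball (0 : 'rV[R]_n).
Proof. by apply/unit_ballE; rewrite dot0l. Qed.

End DotProduct.

(** * The maps h_c: norm identities and involutivity *)

Section MoebiusTransformations.
Variables (R : realType) (n : nat).
Implicit Types c x y : 'rV[R]_n.

(** For nonzero c this is |c|^2 |x - c*|^2, where c* = c / |c|^2 is the inverse of c in the unit
    sphere. *)
Definition moebius_den c x : R := 1 - 2 * dot c x + dot c c * dot x x.

Lemma moebius_denE c x :
  enorm (x - c) ^+ 2 + (1 - enorm c ^+ 2) * (1 - enorm x ^+ 2)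
  = moebius_den c x.
Proof.
by rewrite !enorm_sqr dot_sub /moebius_den (dotC x c); ring.
Qed.

Lemma moebius_denC c x : moebius_den c x = moebius_den x c.
Proof. by rewrite /moebius_den dotC [X in _ + X]mulrC. Qed.

Lemma moebius_den0l x : moebius_den 0 x = 1.
Proof. by rewrite /moebius_den !dot0l mulr0 subr0 mul0r addr0. Qed.

(** The two sides differ by |c|^2 |x|^2 - (c . x)^2. *)
Lemma moebius_den_ge_sqr c x : (1 - dot c x) ^+ 2 <= moebius_den c x.
Proof. have := CauchySchwarz_dot c x; rewrite /moebius_den; nra. Qed.

Lemma dot_lt1 c x : dot c c <= 1 -> dot x x < 1 -> dot c x < 1.
Proof.
move=> c1 x1; rewrite ltNge; apply/negP => cx1.
have := CauchySchwarz_dot c x; have := dotxx_ge0 x; nra.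
Qed.

(** The bound on c is weak so as to include the sphere, for the continuity argument on the closed
    ball. *)
Lemma moebius_den_gt0 c x : dot c c <= 1 -> dot x x < 1 -> 0 < moebius_den c x.
Proof.
move=> c1 x1; apply: lt_le_trans (moebius_den_ge_sqr c x).
by rewrite exprn_gt0 // subr_gt0 dot_lt1.
Qed.

Lemma moebius_hE c x :
  moebius_h c x = ((1 + dot x x - 2 * dot c x) / moebius_den c x) *: c
                  + ((dot c c - 1) / moebius_den c x) *: x.
Proof.
rewrite /moebius_h moebius_denE !enorm_sqr dot_sub (dotC x c).
by apply/rowP => j; rewrite !mxE; ring.
Qed.

Lemma moebius_h_center c : moebius_h c c = 0.
Proof.
by rewrite /moebius_h subrr enorm0 expr0n scale0r scaler0 addr0 scaler0.
Qed.

Lemma dot_moebius_h c x : moebius_den c x != 0 ->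
  1 - dot (moebius_h c x) (moebius_h c x)
  = (1 - dot c c) * (1 - dot x x) / moebius_den c x.
Proof.
move=> D0; rewrite moebius_hE dot_combl !dot_combr (dotC x c).
move: D0; rewrite /moebius_den => D0; field; exact: D0.
Qed.

Lemma unit_ball_moebius c x :
  unit_ball c -> unit_ball x -> unit_ball (moebius_h c x).
Proof.
move=> /unit_ballE c1 /unit_ballE x1; apply/unit_ballE.
have D0 := moebius_den_gt0 (ltW c1) x1.
by rewrite -subr_gt0 dot_moebius_h ?gt_eqF // divr_gt0 // mulr_gt0 // subr_gt0.
Qed.

Lemma moebius_den_moebius c x y :
  moebius_den c x != 0 -> moebius_den c y != 0 ->
  moebius_den (moebius_h c y) (moebius_h c x)
  = (1 - dot c c) ^+ 2 * moebius_den y x / (moebius_den c y * moebius_den c x).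
Proof.
move=> Dx Dy; rewrite {1}/moebius_den.
have /eqP := dot_moebius_h Dx; rewrite subr_eq addrC -subr_eq => /eqP <-.
have /eqP := dot_moebius_h Dy; rewrite subr_eq addrC -subr_eq => /eqP <-.
rewrite !moebius_hE dot_combl !dot_combr (dotC y c).
move: Dx Dy; rewrite /moebius_den => Dx Dy; field.
by rewrite Dx Dy.
Qed.

Lemma moebius_hK c x : unit_ball c -> unit_ball x ->
  moebius_h c (moebius_h c x) = x.
Proof.
move=> c1 x1; have /unit_ballE u1 := unit_ball_moebius c1 x1.
move/unit_ballE: c1 x1 => c1 /unit_ballE x1.
have D0 := gt_eqF (moebius_den_gt0 (ltW c1) x1).
have a0 : 1 - dot c c != 0 by rewrite subr_eq0 gt_eqF.
(* Since h_c(0) = c, this is the identity of [moebius_den_moebius] at y = 0. *)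
have hD : moebius_den c (moebius_h c x)
          = (1 - dot c c) ^+ 2 / moebius_den c x.
  rewrite {1}/moebius_den.
  have /eqP := dot_moebius_h (negbT D0).
  rewrite subr_eq addrC -subr_eq => /eqP <-.
  rewrite moebius_hE dot_combr.
  move: D0; rewrite /moebius_den => /negbT D0; field; exact: D0.
rewrite moebius_hE hD.
have /eqP := dot_moebius_h (negbT D0).
rewrite subr_eq addrC -subr_eq => /eqP <-.
rewrite moebius_hE dot_combr; apply/rowP => j; rewrite !mxE.
move: D0; rewrite /moebius_den => /negbT D0; field; by rewrite D0 a0.
Qed.

End MoebiusTransformations.

(** * Tangent and chord inequalities for the logarithm *)

Section LogInequalities.
Variable R : realType.
Implicit Types r s v : R.

Lemma ln_le_sub1 v : 0 < v -> ln v <= v - 1.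
Proof.
move=> v0; have := @le_ln1Dx R (v - 1); rewrite addrCA subrr addr0; apply.
by rewrite ltrBrDr addNr.
Qed.

Lemma ln_lt_sub1 v : 0 < v -> v != 1 -> ln v < v - 1.
Proof.
move=> v0 v1; rewrite -[X in _ < X]expRK ltr_ln ?posrE ?expR_gt0 //.
have := @expR_gt1Dx R (v - 1); rewrite addrCA subrr addr0; apply.
by rewrite subr_eq0.
Qed.

(** Strict concavity of ln: 1 - r s is the mean of 1 - r and 1 + r with weights (1 + s) / 2 and (1 -
    s) / 2. The tangent at 1 - r s is used at both ends, and its weighted increments cancel. *)
Lemma ln_chord r s : 0 < r < 1 -> -1 < s < 1 ->
  (1 + s) * ln (1 - r) + (1 - s) * ln (1 + r) < 2 * ln (1 - r * s).
Proof.
move=> /andP[r0 r1] /andP[s0 s1].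
have b0 : 0 < 1 - r * s by nra.
have m0 : 0 < 1 - r by lra.
have p0 : 0 < 1 + r by lra.
have bE : 1 - r * s != 0 by rewrite gt_eqF.
have Hm : ln (1 - r) - ln (1 - r * s) < (1 - r) / (1 - r * s) - 1.
  rewrite -ln_div ?posrE // ln_lt_sub1 ?divr_gt0 //.
  by rewrite lt_eqF // ltr_pdivrMr // mul1r; nra.
have Hp : ln (1 + r) - ln (1 - r * s) <= (1 + r) / (1 - r * s) - 1.
  by rewrite -ln_div ?posrE // ln_le_sub1 ?divr_gt0.
have E : (1 + s) * ((1 - r) / (1 - r * s) - 1)
         + (1 - s) * ((1 + r) / (1 - r * s) - 1) = 0 by field.
have s1' : 0 < 1 + s by lra.
have s2' : 0 <= 1 - s by lra.
move: Hm; rewrite -(ltr_pM2l s1') => Hm.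
have := ler_wpM2l s2' Hp; lra.
Qed.

End LogInequalities.

(** * Invariance of the energy, and minima at the origin *)

Section Energy.
Variables (R : realType) (n : nat).
Implicit Types c x y z : 'rV[R]_n.

(* The squared hyperbolic cosine of half the hyperbolic distance. *)
Definition cosh2 y x : R :=
  moebius_den y x / ((1 - dot y y) * (1 - dot x x)).

Lemma cosh2_gt0 y x : unit_ball y -> unit_ball x -> 0 < cosh2 y x.
Proof.
move=> /unit_ballE y1 /unit_ballE x1.
by rewrite divr_gt0 ?moebius_den_gt0 ?mulr_gt0 ?subr_gt0 // ltW.
Qed.

Lemma ln_cosh2 y x : unit_ball y -> unit_ball x ->
  ln (cosh2 y x)
  = ln (moebius_den y x) - ln (1 - dot y y) - ln (1 - dot x x).
Proof.
move=> /unit_ballE y1 /unit_ballE x1.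
have D0 := moebius_den_gt0 (ltW y1) x1.
by rewrite ln_div ?lnM ?posrE ?mulr_gt0 ?subr_gt0 // opprD addrA.
Qed.

Lemma cosh2_moebius c y x : unit_ball c -> unit_ball y -> unit_ball x ->
  cosh2 (moebius_h c y) (moebius_h c x) = cosh2 y x.
Proof.
move=> /unit_ballE c1 /unit_ballE y1 /unit_ballE x1.
have Dx : moebius_den c x != 0 by rewrite gt_eqF // moebius_den_gt0 // ltW.
have Dy : moebius_den c y != 0 by rewrite gt_eqF // moebius_den_gt0 // ltW.
rewrite /cosh2 moebius_den_moebius // !dot_moebius_h //; field.
by rewrite Dx Dy !subr_eq0 !gt_eqF.
Qed.

Lemma GN_cosh2 N (x : 'I_N -> 'rV[R]_n) y :
  unit_ball y -> (forall k, unit_ball (x k)) ->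
  GN x y = \sum_(k < N) ln (cosh2 y (x k)).
Proof.
move=> y1 x1; rewrite /GN -sumrN; apply: eq_bigr => k _.
rewrite moebius_denE moebius_denC !enorm_sqr.
by rewrite -(invf_div (moebius_den _ _)) lnV ?posrE ?cosh2_gt0 // opprK.
Qed.

Lemma GN_moebius N (x : 'I_N -> 'rV[R]_n) c y :
  unit_ball c -> unit_ball y -> (forall k, unit_ball (x k)) ->
  GN (moebius_h c \o x) (moebius_h c y) = GN x y.
Proof.
move=> c1 y1 x1.
rewrite !GN_cosh2 //; first last.
- by move=> k; exact: unit_ball_moebius.
- exact: unit_ball_moebius.
by apply: eq_bigr => k _; rewrite cosh2_moebius.
Qed.

(* With s_k = (u_k . z) / |z|, Cauchy-Schwarz bounds the k-th denominator below
   by (1 - |z| s_k)^2, and [ln_chord] applies; the linear parts of the chords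
   add up to 0. *)
Lemma GN_center_lt N (u : 'I_N -> 'rV[R]_n) z : (0 < N)%N ->
  (forall k, unit_ball (u k)) -> \sum_k u k = 0 ->
  unit_ball z -> z != 0 -> GN u 0 < GN u z.
Proof.
move=> N0 u1 su z1 z0; rewrite !GN_cosh2 //; last exact: unit_ball0.
pose r := enorm z; have rE : dot z z = r ^+ 2 by rewrite enorm_sqr.
have r0 : 0 < r by rewrite lt_def enorm_eq0 z0 sqrtr_ge0.
(* Slope of the chord of s |-> 2 ln (1 - r s) over [-1, 1]. *)
pose K := ln (1 - r) - ln (1 + r).
have -> : \sum_k ln (cosh2 0 (u k))
        = \sum_k (ln (cosh2 0 (u k)) + dot z (u k) / r * K).
  by rewrite big_split /= -!mulr_suml -dot_sumr su dotC dot0l !mul0r addr0.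
apply: ltr_sum => [|k _].
  by apply/hasP; exists (Ordinal N0); rewrite ?mem_index_enum.
rewrite !ln_cosh2 //; last exact: unit_ball0.
rewrite moebius_den0l dot0l subr0 ln1 subrr sub0r rE.
move: (u1 k) z1 => /unit_ballE uk /unit_ballE z1.
have r1 : r < 1 by move: z1; rewrite rE; nra.
set s := dot z (u k) / r.
have sE : dot z (u k) = r * s by rewrite mulrC divfK ?gt_eqF.
have s1 : s ^+ 2 < 1.
  rewrite -(@ltr_pM2l _ (r ^+ 2)) ?exprn_gt0 // mulr1 -exprMn -sE.
  apply: le_lt_trans (CauchySchwarz_dot _ _) _.
  by rewrite rE gtr_pMr ?exprn_gt0.
have s01 : -1 < s < 1 by apply/andP; split; nra.
have b0 : 0 < 1 - r * s by rewrite -sE subr_gt0 dot_lt1 // ltW.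
have lnD : 2 * ln (1 - r * s) <= ln (moebius_den z (u k)).
  have D0 := moebius_den_gt0 (ltW z1) uk.
  rewrite mulr_natl -lnXn // -sE ler_ln ?moebius_den_ge_sqr // posrE sE.
  exact: exprn_gt0.
have -> : 1 - r ^+ 2 = (1 - r) * (1 + r) by ring.
have rr : 0 < r < 1 by rewrite r0.
rewrite lnM ?posrE ?subr_gt0 // ?addr_gt0 //.
have := ln_chord rr s01; rewrite /K; lra.
Qed.

Lemma GN_argmin_center N (u : 'I_N -> 'rV[R]_n) :
  (forall k, unit_ball (u k)) ->
  (forall z, unit_ball z -> GN u 0 <= GN u z) -> \sum_k u k = 0.
Proof.
move=> u1 umin; set w := \sum_k u k; apply/eqP; rewrite -dotxx_eq0.
apply/negPn/negP => w0; pose W := dot w w.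
have W0 : 0 < W by rewrite lt_def w0 dotxx_ge0.
have NR0 : 0 <= N%:R :> R by exact: ler0n.
(* The summand 4 N of [m] gives t N <= 1/4; the summand W + 1 gives t W <= 1 - t, whence v <= t (1 -
   t) <= 1/4. *)
pose m : R := 4 * N%:R + W + 1; have m0 : 0 < m by rewrite /m; lra.
pose t := m^-1; have tm : t * m = 1 by rewrite mulVf ?gt_eqF.
have t0 : 0 < t by rewrite invr_gt0.
have tN : t * N%:R <= 4^-1 by move: tm; rewrite /m; nra.
pose v := t ^+ 2 * W; have v0 : 0 < v by rewrite mulr_gt0 ?exprn_gt0.
have v4 : v <= 4^-1.
  have tW : t * W <= 1 - t by move: tm (mulr_ge0 (ltW t0) NR0); rewrite /m; lra.
  rewrite /v; have := sqr_ge0 (t - 2^-1); move: (ler_wpM2l (ltW t0) tW); lra.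
have zz : dot (t *: w) (t *: w) = v.
  by rewrite dotZl dotC dotZl /v mulrA -expr2.
have z1 : unit_ball (t *: w) by apply/unit_ballE; rewrite zz; lra.
(* The first [v] dominates the term |t w|^2 |u_k|^2 of the denominator; the rest bounds - ln (1 -
   v). *)
pose B := v + ((1 - v)^-1 - 1).
have up k : ln (cosh2 (t *: w) (u k))
    <= ln (cosh2 0 (u k)) + (- (2 * (t * dot w (u k))) + B).
  rewrite !ln_cosh2 //; last exact: unit_ball0.
  rewrite moebius_den0l dot0l subr0 ln1 subrr sub0r [leRHS]addrC lerD2r zz.
  move: (u1 k) z1 => /unit_ballE uk /unit_ballE z1.
  have D0 := moebius_den_gt0 (ltW z1) uk.
  have v1 : 0 < 1 - v by rewrite -zz subr_gt0.
  rewrite -lnV ?posrE // /B addrA; apply: lerD; last first.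
    by rewrite ln_le_sub1 ?invr_gt0.
  apply: le_trans (ln_le_sub1 D0) _.
  rewrite /moebius_den dotZl zz; nra.
have := umin _ z1; rewrite !GN_cosh2 //; last exact: unit_ball0.
apply/negP; rewrite -ltNge.
apply: (le_lt_trans (ler_sum _ (fun k _ => up k))).
rewrite big_split gtrDl big_split /= sumrN -!mulr_sumr -dot_sumr -/w -/W.
rewrite sumr_const card_ord -mulr_natl.
have vi : (1 - v)^-1 - 1 <= 4 / 3 * v.
  have v1 : 0 < 1 - v by lra.
  have iv : (1 - v)^-1 * (1 - v) = 1 by rewrite mulVf ?gt_eqF.
  have i0 : 0 <= (1 - v)^-1 by rewrite invr_ge0 ltW.
  have i43 : (1 - v)^-1 <= 4 / 3 by have := ler_wpM2l i0 v4; lra.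
  have := ler_wpM2l (ltW v0) i43; lra.
have NB : N%:R * B <= N%:R * (7 / 3 * v) by rewrite ler_wpM2l // /B; lra.
(* The error is 7/3 (t N) (t W) <= 7/12 t W, less than the gain 2 t W. *)
apply: (@le_lt_trans _ _ (- (2 * (t * W)) + N%:R * (7 / 3 * v))); first by lra.
have -> : N%:R * (7 / 3 * v) = 7 / 3 * (t * N%:R) * (t * W) by rewrite /v; ring.
have := mulr_gt0 t0 W0; nra.
Qed.

End Energy.

(** * Existence of a minimum by compactness *)

Section Existence.
Variables (R : realType) (n : nat).

Lemma continuous_dot (T : topologicalType) (f g : T -> 'rV[R]_n) :
  continuous f -> continuous g -> continuous (fun t => dot (f t) (g t)).
Proof.
move=> cf cg; apply: continuous_big => [|j _]; first exact: add_continuous.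
have coordP (h : T -> 'rV[R]_n) : continuous h -> continuous (fun t => h t 0 j).
  move=> ch t; apply: (@continuous_comp _ _ _ h (fun v => v 0 j)).
    exact: ch.
  exact: coord_continuous.
by move=> t; apply: cvgM; exact: coordP.
Qed.

(** A closed subset of the cube [-1, 1]^n, which is compact as a product of segments. *)
Lemma compact_closed_ball : compact [set y : 'rV[R]_n | dot y y <= 1].
Proof.
have box := @rV_compact R n (fun=> `[-1, 1]%classic)
                          (fun=> @segment_compact R (-1) 1).
apply: subclosed_compact box _ => [|y /= y1 j].
  apply: (@preimage_closed _ _ (fun y => dot y y) [set r | r <= 1]).
    by move=> y _; apply: continuous_dot => z; exact: cvg_id.
  exact: closed_le.
have yj : y 0 j ^+ 2 <= 1.
  apply: le_trans y1; rewrite /dot (bigD1 j) //= -expr2 lerDl.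
  by apply: sumr_ge0 => i _; rewrite -expr2 sqr_ge0.
by rewrite in_itv /=; apply/andP; split; nra.
Qed.

Lemma expR_GN N (x : 'I_N -> 'rV[R]_n) y :
  unit_ball y -> (forall k, unit_ball (x k)) ->
  expR (- GN x y) = \prod_(k < N) (cosh2 y (x k))^-1.
Proof.
move=> y1 x1; rewrite GN_cosh2 // -sumrN expR_sum; apply: eq_bigr => k _.
by rewrite expRN lnK // posrE cosh2_gt0.
Qed.

(* Pitfall: on the sphere [cosh2] is a division by 0, so that it and its inverse
   are 0, which is the value of the continuous extension used below. *)
Lemma GN_argmin_exists N (x : 'I_N -> 'rV[R]_n) : (0 < N)%N ->
  (forall k, unit_ball (x k)) ->
  exists2 c, unit_ball c & forall y, unit_ball y -> GN x c <= GN x y.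
Proof.
move=> N0 x1; pose B := [set y : 'rV[R]_n | dot y y <= 1].
pose P (y : 'rV[R]_n) := \prod_(k < N) (cosh2 y (x k))^-1.
have sub y : unit_ball y -> B y by move=> /unit_ballE /ltW.
have B0 : B !=set0 by exists 0; apply: sub; exact: unit_ball0.
have cP : {within B, continuous P}.
  apply: continuous_in_subspaceT => y /set_mem y1.
  apply: (@cvg_big _ _ _ _ _ mul_continuous _ (nbhs y)) => k _.
  have /unit_ballE xk := x1 k.
  have D0 : moebius_den y (x k) != 0 by rewrite gt_eqF // moebius_den_gt0.
  have cid : continuous (fun z : 'rV[R]_n => z) by move=> z; exact: cvg_id.
  have cc : continuous (fun _ : 'rV[R]_n => x k) by exact: cst_continuous.
  have cyy := continuous_dot cid cid.
  have cyx := continuous_dot cid cc.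
  (* In this form only [moebius_den] is inverted, and it does not vanish on the closed ball. *)
  have -> : (fun z => (cosh2 z (x k))^-1) = (fun z =>
      (1 - dot z z) * (1 - dot (x k) (x k)) * (moebius_den z (x k))^-1).
    by apply/funext => z; rewrite /cosh2 invf_div.
  rewrite /cosh2 invf_div; apply: cvgM.
    by apply: cvgM (cvg_cst _); apply: cvgB (cyy y); exact: cvg_cst.
  apply: cvgV => //; apply: cvgD.
    by apply: cvgB; [exact: cvg_cst|apply: cvgM (cyx y); exact: cvg_cst].
  by apply: cvgM (cyy y) (cvg_cst _).
have [c /set_mem cB cmax] := EVT_max_rV B0 compact_closed_ball cP.
(* The maximum of [P] is positive, whereas [P] vanishes on the sphere because N > 0 provides a zero
   factor; so c is interior. *)
have P0 : 0 < P 0 by rewrite /P -expR_GN ?expR_gt0 //; exact: unit_ball0.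
have c1 : unit_ball c.
  apply/unit_ballE; rewrite lt_neqAle cB andbT; apply/eqP => cc.
  have := cmax 0 (mem_set (sub _ (@unit_ball0 _ _))); rewrite leNgt.
  suff -> : P c = 0 by rewrite P0.
  rewrite /P (bigD1 (Ordinal N0)) //= /cosh2 cc subrr mul0r invr0 mulr0 invr0.
  by rewrite mul0r.
exists c => // y y1; have := cmax y (mem_set (sub _ y1)).
by rewrite /P -!expR_GN // ler_expR lerN2.
Qed.

End Existence.

(** * Inverses of linear isometries *)

Section LinearIsometries.
Variables (R : realType) (n : nat).
Implicit Types S T : {linear 'rV[R]_n -> 'rV[R]_n}.

Lemma linear_isometry_eq0 T v : linear_isometry T -> T v = 0 -> v = 0.
Proof.
by move=> isoT Tv; apply/eqP; rewrite -enorm_eq0 -isoT Tv enorm0.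
Qed.

(** An isometry has trivial kernel, so its square matrix is invertible. *)
Lemma linear_isometry_inv T : linear_isometry T ->
  exists2 S, linear_isometry S & cancel T S.
Proof.
move=> isoT; have uT : lin1_mx T \in unitmx.
  rewrite -row_free_unit -kermx_eq0; apply/eqP/row_matrixP => i; rewrite row0.
  apply: (linear_isometry_eq0 isoT); rewrite -mul_rV_lin1 -row_mul mulmx_ker.
  exact: row0.
exists (mulmxr (invmx (lin1_mx T))) => v /=; last first.
  by rewrite -mul_rV_lin1 mulmxK.
by rewrite -isoT -mul_rV_lin1 mulmxKV.
Qed.

End LinearIsometries.

(** * Transport between the minimum c and the origin *)

Section BalancedMoebius.
Variables (R : realType) (n N : nat) (x : 'I_N -> 'rV[R]_n).
Hypothesis x1 : forall k, unit_ball (x k).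

Lemma GN_moebius_center c : unit_ball c -> GN (moebius_h c \o x) 0 = GN x c.
Proof. by move=> c1; rewrite -(GN_moebius c1 c1 x1) moebius_h_center. Qed.

Lemma sum_moebius_unique_argmin c : (0 < N)%N -> unit_ball c ->
  \sum_k moebius_h c (x k) = 0 -> unique_argmin unit_ball (GN x) c.
Proof.
move=> N0 c1 su; have u1 k : unit_ball (moebius_h c (x k)).
  exact: unit_ball_moebius.
have lt_c y : unit_ball y -> c != y -> GN x c < GN x y.
  move=> y1 cy; rewrite -GN_moebius_center // -(GN_moebius c1 y1 x1).
  apply: (GN_center_lt N0 u1 su); first exact: unit_ball_moebius.
  (* h_c sends c to 0 and is injective on the ball, being an involution. *)
  apply: contra_neq cy => hy.
  by rewrite -(moebius_hK c1 y1) hy -(moebius_h_center c) moebius_hK.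
split=> [|y [y1 ymin]].
  by split=> // y y1; have [->//|/(lt_c _ y1)/ltW] := eqVneq c y.
apply/eqP/negPn/negP => /(lt_c _ y1); rewrite ltNge => /negP; apply.
exact: ymin.
Qed.

Lemma argmin_sum_moebius c : unit_ball c ->
  (forall y, unit_ball y -> GN x c <= GN x y) ->
  \sum_k moebius_h c (x k) = 0.
Proof.
move=> c1 cmin; apply: GN_argmin_center => [k|z z1] /=.
  exact: unit_ball_moebius.
(* Writing z as h_c(h_c(z)) turns the energy of the moved points at z into that of the original ones
   at h_c(z). *)
rewrite GN_moebius_center // -(moebius_hK c1 z1) GN_moebius //.
  by apply: cmin; exact: unit_ball_moebius.
exact: unit_ball_moebius.
Qed.

End BalancedMoebius.

Theorem corollary4p4 (R : realType) (n N : nat) (hN : (0 < N)%N)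
    (x : 'I_N -> 'rV[R]_n) (hx : forall k, unit_ball (x k)) :
  [/\ (exists h : 'rV[R]_n -> 'rV[R]_n,
         moebius_ball h /\ \sum_(k < N) h (x k) = 0),
      (forall h h' : 'rV[R]_n -> 'rV[R]_n,
         moebius_ball h -> \sum_(k < N) h (x k) = 0 ->
         moebius_ball h' -> \sum_(k < N) h' (x k) = 0 ->
         exists T : {linear 'rV[R]_n -> 'rV[R]_n},
           linear_isometry T /\ {in unit_ball, h' =1 T \o h})
    & (forall (h : 'rV[R]_n -> 'rV[R]_n) (T : {linear 'rV[R]_n -> 'rV[R]_n})
              (c : 'rV[R]_n),
         \sum_(k < N) h (x k) = 0 -> moebius_decomp h T c ->
         unique_argmin unit_ball (GN x) c)].
Proof.
have argminP h T c : \sum_(k < N) h (x k) = 0 -> moebius_decomp h T c ->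
    unique_argmin unit_ball (GN x) c.
  move=> sh [isoT c1 hE]; apply: (sum_moebius_unique_argmin hx hN c1).
  (* T is injective, so it can be removed from the vanishing sum. *)
  apply: (linear_isometry_eq0 isoT); rewrite linear_sum -[RHS]sh.
  by apply: eq_bigr => k _; rewrite hE //; exact/mem_set.
split=> [|h h' [T [c dh]] sh [T' [c' dh']] sh'|//].
  have [c c1 cmin] := GN_argmin_exists hN hx.
  exists (moebius_h c); split.
    by exists idfun, c; split.
  exact: argmin_sum_moebius.
(* Both c and c' minimize [GN x], so they coincide; h and h' then differ only by their isometries,
   and T' after the inverse of T relates them. *)
have [_ /(_ c')] := argminP _ _ _ sh dh.
have [c'min _] := argminP _ _ _ sh' dh'; move/(_ c'min) => cc'.
move: dh dh'; rewrite -{c'min}cc' => -[isoT _ hE] [isoT' _ hE'].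
have [S isoS TK] := linear_isometry_inv isoT.
exists (T' \o S : {linear _ -> _}); split=> [v|y y1] /=; first by rewrite isoT'.
by rewrite hE // hE' //= TK.
Qed.
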